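(* Let $g$ be a coupling function such that the globally coupled system of $N$ phase oscillators $$\frac{d\theta_i}{dt}=\omega+\frac1N\sum_{j=1}^N g(\theta_i-\theta_j),\qquad i=1,\dots,N,$$ has a periodic three-cluster state with relative phases $\phi_1,\phi_2,\phi_3$ and nontrivial clusters of sizes $m_1,m_2,m_3$ (so $m_k\ge 2$ and $m_1+m_2+m_3=N$). Suppose that this state is tangentially stable, and that $K_1\le K_2\le K_3$, where $$K_1=\frac{1}{m_1}(m_2g'_{12}+m_3g'_{13}),\quad K_2=\frac{1}{m_2}(m_1g'_{21}+m_3g'_{23}),\quad K_3=\frac{1}{m_3}(m_1g'_{31}+m_2g'_{32}).$$ Then the transverse eigenvalues $\lambda_4^{tran},\lambda_5^{tran},\lambda_6^{tran}$ of the first, second and third cluster respectively satisfy: (1) if $-g'_0<K_1$, then $\lambda_4^{tran}>0$, $\lambda_5^{tran}>0$ and $\lambda_6^{tran}>0$ (all clusters unstable); (2) if $K_1<-g'_0<K_2$, then $\lambda_4^{tran}<0$, $\lambda_5^{tran}>0$ and $\lambda_6^{tran}>0$ (one stable cluster); (3) if $K_2<-g'_0<K_3$, then $\lambda_4^{tran}<0$, $\lambda_5^{tran}<0$ and $\lambda_6^{tran}>0$ (two stable clusters); (4) if $K_3<-g'_0$, then $\lambda_4^{tran}<0$, $\lambda_5^{tran}<0$ and $\lambda_6^{tran}<0$ (all clusters stable).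
   Context: Here $\mathbb{T}=[0,2\pi)$ is the circle of phases (taken mod $2\pi$), $\theta_i\in\mathbb{T}$, $\omega\in\mathbb{R}$ is a constant, and a coupling function is a smooth $2\pi$-periodic function $g:\mathbb{T}\to\mathbb{R}$. A periodic three-cluster state is given by a partition of $\{1,\dots,N\}$ into three clusters $p_1,p_2,p_3$ with $|p_k|=m_k$, pairwise distinct relative phases $\phi_1,\phi_2,\phi_3\in\mathbb{T}$ and a frequency $\Omega>0$ such that $\theta_i(t)=\phi_k+\Omega t$ for all $i\in p_k$ solves the system; that is, $\Omega=\omega+\frac1N\sum_{\ell=1}^3 m_\ell\, g(\phi_k-\phi_\ell)$ for $k=1,2,3$. A cluster $p_k$ is nontrivial if $m_k>1$. Notation: $g'_0=g'(0)$ and, for $k\ne\ell$, $g'_{k\ell}=g'(\phi_k-\phi_\ell)$. Tangential stability: perturbations preserving the clustering satisfy, to first order, $\frac{d\chi_k}{dt}=\frac1N\sum_{\ell=1}^3 m_\ell\, g'(\phi_k-\phi_\ell)(\chi_k-\chi_\ell)=\sum_{\ell=1}^3T_{k\ell}\chi_\ell$, i.e. $T_{kk}=\frac1N\sum_{r\neq k}m_r g'_{kr}$ and $T_{k\ell}=-\frac1N m_\ell g'_{k\ell}$ for $\ell\ne k$. The $3\times3$ matrix $T$ always has one trivial eigenvalue $0$ (eigenvector $(1,1,1)$). The state is tangentially stable if the other two eigenvalues of $T$ (counted with multiplicity) have negative real parts. Transverse eigenvalues: the eigenvalues of the linearization of the system about the state (in the co-rotating frame) for perturbations that split one cluster are $$\lambda_4^{tran}=\tfrac1N(m_1g'_0+m_2g'_{12}+m_3g'_{13}),\quad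 \lambda_5^{tran}=\tfrac1N(m_1g'_{21}+m_2g'_0+m_3g'_{23}),\quad \lambda_6^{tran}=\tfrac1N(m_1g'_{31}+m_2g'_{32}+m_3g'_0),$$ associated with clusters $1,2,3$ and with multiplicities $m_1-1,m_2-1,m_3-1$ respectively. A cluster is called stable (unstable) if its transverse eigenvalue is negative (positive). *)

(* Defs.v *)
From HB Require Import structures.
From mathcomp Require Import all_boot all_order all_algebra.
From mathcomp Require Import complex.
From mathcomp Require Import all_classical all_reals all_analysis.

Set Implicit Arguments.
Unset Strict Implicit.
Unset Printing Implicit Defensive.

Import Order.TTheory GRing.Theory Num.Theory.
Import numFieldNormedType.Exports.

Local Open Scope classical_set_scope.
Local Open Scope ring_scope.

(* Functions on the circle R / 2 pi Z are represented by 2 pi-periodic functions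
   on R. *)
Definition coupling_function (R : realType) (g : R -> R) : Prop :=
  (forall (n : nat) (x : R), derivable (g^`(n))%classic x 1)
  /\ periodic g (pi *+ 2).

Definition phase_field (R : realType) (N : nat) (omega : R) (g : R -> R)
    (x : 'I_N -> R) (i : 'I_N) : R :=
  omega + N%:R^-1 * \sum_(j < N) g (x i - x j).

(* Only differences of phases enter the field, so a solution on the torus is
   represented by a lift to R. *)
Definition solves_phase_system (R : realType) (N : nat) (omega : R) (g : R -> R)
    (theta : 'I_N -> R -> R) : Prop :=
  forall (i : 'I_N) (t : R),
    is_derive t (1 : R) (theta i) (phase_field omega g (theta^~ t) i).

Definition cluster1 : 'I_3 := @Ordinal 3 0 isT.
Definition cluster2 : 'I_3 := @Ordinal 3 1 isT.
Definition cluster3 : 'I_3 := @Ordinal 3 2 isT.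

(* A partition p_1, p_2, p_3 of the oscillators is given by the function c that
   maps each oscillator to the cluster containing it: p_k = {i | c i = k}. *)
Record three_cluster_state (R : realType) (N : nat) (omega : R) (g : R -> R)
    (c : 'I_N -> 'I_3) (m : 'I_3 -> nat) (phi : 'I_3 -> R) (Omega : R) : Prop := {
  cluster_size : forall k, #|[pred i | c i == k]| = m k;
  cluster_nonempty : forall k, (0 < m k)%N;
  phase_circle : forall k, 0 <= phi k < pi *+ 2;
  phase_distinct : injective phi;
  frequency_gt0 : 0 < Omega;
  cluster_solution :
    solves_phase_system omega g (fun (i : 'I_N) (t : R) => phi (c i) + Omega * t)
}.

Definition tangential_matrix (R : realType) (N : nat) (g : R -> R)
    (m : 'I_3 -> nat) (phi : 'I_3 -> R) : 'M[R]_3 :=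
  \matrix_(k, l)
    if l == k
    then N%:R^-1 * \sum_(r | r != k) (m r)%:R * g^`()%classic (phi k - phi r)
    else - (N%:R^-1 * (m l)%:R * g^`()%classic (phi k - phi l)).

(* The complex eigenvalues with multiplicity are the roots of the
   characteristic polynomial: the trivial 0, then z and w. *)
Definition tangentially_stable (R : realType) (N : nat) (g : R -> R)
    (m : 'I_3 -> nat) (phi : 'I_3 -> R) : Prop :=
  exists z w : R[i],
    [/\ char_poly (map_mx (real_complex R) (tangential_matrix N g m phi))
          = 'X * ('X - z%:P) * ('X - w%:P),
        complex.Re z < 0 & complex.Re w < 0].

Definition transverse_eigenvalue (R : realType) (N : nat) (g : R -> R)
    (m : 'I_3 -> nat) (phi : 'I_3 -> R) (k : 'I_3) : R :=
  N%:R^-1 * ((m k)%:R * g^`()%classic 0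
             + \sum_(l | l != k) (m l)%:R * g^`()%classic (phi k - phi l)).

Definition transverse_threshold (R : realType) (g : R -> R)
    (m : 'I_3 -> nat) (phi : 'I_3 -> R) (k : 'I_3) : R :=
  (m k)%:R^-1 * \sum_(l | l != k) (m l)%:R * g^`()%classic (phi k - phi l).

(* A perturbation v that splits cluster k (supported there, with sum 0) is an
   eigenvector, for transverse_eigenvalue k, of the linearization of the system
   about the state in the frame rotating with it. *)
Lemma transverse_eigenvalueP (R : realType) (N : nat) (omega : R) (g : R -> R)
    (c : 'I_N -> 'I_3) (m : 'I_3 -> nat) (phi : 'I_3 -> R)
    (k : 'I_3) (v : 'I_N -> R) :
  coupling_function g ->
  (forall l, #|[pred i | c i == l]| = m l) ->
  (forall i, c i != k -> v i = 0) -> \sum_i v i = 0 ->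
  forall i, is_derive (0 : R) (1 : R)
    (fun s : R => phase_field omega g (fun j => phi (c j) + s * v j) i)
    (transverse_eigenvalue N g m phi k * v i).
Proof.
move=> [gs _] cm v0 sv i.
have dg (x : R) : is_derive x (1 : R) g (g^`()%classic x).
  by rewrite derive1E; apply: DeriveDef => //; exact: (gs 0%N x).
have dj (j : 'I_N) : is_derive (0 : R) (1 : R)
    (fun s : R => g (phi (c i) + s * v i - (phi (c j) + s * v j)))
    ((v i - v j) * g^`()%classic (phi (c i) - phi (c j))).
  pose h (s : R) := phi (c i) + s * v i - (phi (c j) + s * v j).
  have dh : is_derive (0 : R) (1 : R) h (v i - v j).
    rewrite /h; apply: is_derive_eq.
    by rewrite !scaler0 !add0r !mul1r /GRing.scale /= !mulr1.
  have h0 : h 0 = phi (c i) - phi (c j) by rewrite /h !mul0r !addr0.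
  have dgh : is_derive (h 0) (1 : R) g (g^`()%classic (phi (c i) - phi (c j))).
    by rewrite h0; exact: dg.
  by rewrite mulrC; exact: (@is_derive1_comp R g h 0).
have dS : is_derive (0 : R) (1 : R)
    (\sum_(j < N) (fun s : R => g (phi (c i) + s * v i - (phi (c j) + s * v j))))
    (\sum_(j < N) (v i - v j) * g^`()%classic (phi (c i) - phi (c j))).
  by apply: is_derive_sum => j; exact: dj.
have -> : (fun s : R => phase_field omega g (fun j => phi (c j) + s * v j) i)
  = cst omega + N%:R^-1 *: (\sum_(j < N)
      (fun s : R => g (phi (c i) + s * v i - (phi (c j) + s * v j)))).
  by apply/funext => s; rewrite /phase_field !fctE fct_sumE.
apply: is_derive_eq.
rewrite add0r /transverse_eigenvalue /GRing.scale /= -[RHS]mulrA; congr (_ * _).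
under eq_bigr do rewrite mulrBl.
rewrite sumrB.
have -> : \sum_(j < N) v j * g^`()%classic (phi (c i) - phi (c j)) = 0.
  transitivity (\sum_(j < N) v j * g^`()%classic (phi (c i) - phi k)).
    apply: eq_bigr => j _; have [<-//|/eqP/v0->] := c j =P k; by rewrite !mul0r.
  by rewrite -mulr_suml sv mul0r.
rewrite subr0 -mulr_sumr mulrC.
have [cik|/eqP/v0->] := c i =P k; last by rewrite !mulr0.
congr (_ * _); rewrite cik.
rewrite (partition_big c xpredT) //= (bigD1 k) //=.
have E l : \sum_(j < N | c j == l) g^`()%classic (phi k - phi (c j))
           = (m l)%:R * g^`()%classic (phi k - phi l).
  rewrite -cm mulr_natl -sumr_const; apply: eq_big => [j|j /eqP->//].
  by rewrite !inE.
rewrite E subrr; congr (_ + _).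
by apply: eq_bigr => l _; exact: E.
Qed.

(* Main.v *)
Require Import Defs.
From HB Require Import structures.
From mathcomp Require Import all_boot all_order all_algebra.
From mathcomp Require Import complex.
From mathcomp Require Import all_classical all_reals all_analysis.
From mathcomp Require Import lra.

Set Implicit Arguments.
Unset Strict Implicit.
Unset Printing Implicit Defensive.

Import Order.TTheory GRing.Theory Num.Theory.
Import numFieldNormedType.Exports.

Local Open Scope classical_set_scope.
Local Open Scope ring_scope.

(** Each transverse eigenvalue factors as $\frac{m_k}{N}(g'_0+K_k)$ ([transverse_eigenvalueE]). The
    prefactor is positive, so the eigenvalue is positive exactly when $-g'_0<K_k$ and negative
    exactly when $K_k<-g'_0$ ([transverse_eigenvalue_sign]). Since $K_1\le K_2\le K_3$, the place of
    $-g'_0$ among the thresholds fixes all three signs. *)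

Lemma transverse_eigenvalueE (R : realType) (N : nat) (g : R -> R)
    (m : 'I_3 -> nat) (phi : 'I_3 -> R) (k : 'I_3) :
  (0 < m k)%N ->
  transverse_eigenvalue N g m phi k
    = (m k)%:R / N%:R * (g^`()%classic 0 + transverse_threshold g m phi k).
Proof.
move=> mk0; rewrite /transverse_eigenvalue /transverse_threshold.
(* Distributing $m_k$ over the sum cancels the $m_k^{-1}$ inside $K_k$, which is where $m_k\neq 0$
   enters. *)
rewrite [RHS]mulrAC [X in _ = X * _]mulrDr mulVKf ?pnatr_eq0 -?lt0n //.
exact: mulrC.
Qed.

(** Dividing by $m_k/N>0$ keeps the sign. Both parts are boolean equalities, so that they can
    rewrite the sign conditions in a goal. *)
Lemma transverse_eigenvalue_sign (R : realType) (N : nat) (g : R -> R)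
    (m : 'I_3 -> nat) (phi : 'I_3 -> R) (k : 'I_3) :
  (0 < m k)%N -> (0 < N)%N ->
  (0 < transverse_eigenvalue N g m phi k)
    = (- g^`()%classic 0 < transverse_threshold g m phi k)
  /\ (transverse_eigenvalue N g m phi k < 0)
    = (transverse_threshold g m phi k < - g^`()%classic 0).
Proof.
move=> mk0 N0; rewrite transverse_eigenvalueE //.
have q0 : 0 < (m k)%:R / N%:R :> R by rewrite divr_gt0 ?ltr0n.
by rewrite pmulr_rgt0 // pmulr_rlt0 // -ltrBlDl sub0r -ltrBrDl sub0r.
Qed.

Theorem theorem4 (R : realType) (N : nat) (omega : R) (g : R -> R)
    (c : 'I_N -> 'I_3) (m : 'I_3 -> nat) (phi : 'I_3 -> R) (Omega : R)
    (hg : coupling_function g)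
    (hstate : three_cluster_state omega g c m phi Omega)
    (hnontrivial : forall k, (1 < m k)%N)
    (htan : tangentially_stable N g m phi) :
  let K1 := transverse_threshold g m phi cluster1 in
  let K2 := transverse_threshold g m phi cluster2 in
  let K3 := transverse_threshold g m phi cluster3 in
  let lambda4 := transverse_eigenvalue N g m phi cluster1 in
  let lambda5 := transverse_eigenvalue N g m phi cluster2 in
  let lambda6 := transverse_eigenvalue N g m phi cluster3 in
  let g'0 := g^`()%classic 0 in
  K1 <= K2 -> K2 <= K3 ->
  [/\ - g'0 < K1 -> [/\ 0 < lambda4, 0 < lambda5 & 0 < lambda6],
      K1 < - g'0 < K2 -> [/\ lambda4 < 0, 0 < lambda5 & 0 < lambda6],
      K2 < - g'0 < K3 -> [/\ lambda4 < 0, lambda5 < 0 & 0 < lambda6]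
    & K3 < - g'0 -> [/\ lambda4 < 0, lambda5 < 0 & lambda6 < 0]].
Proof.
move=> K1 K2 K3 lambda4 lambda5 lambda6 g'0 K12 K23.
have m0 := cluster_nonempty hstate.
have N0 : (0 < N)%N.
  (* The first cluster is a nonempty set of oscillators, so $1\le m_1\le N$. *)
  apply: leq_trans (m0 cluster1) _.
  by rewrite -(cluster_size hstate) -[leqRHS]card_ord max_card.
have [p4 n4] := transverse_eigenvalue_sign g phi (m0 cluster1) N0.
have [p5 n5] := transverse_eigenvalue_sign g phi (m0 cluster2) N0.
have [p6 n6] := transverse_eigenvalue_sign g phi (m0 cluster3) N0.
rewrite /lambda4 /lambda5 /lambda6 p4 p5 p6 n4 n5 n6 -/K1 -/K2 -/K3 -/g'0.
(* Only comparisons of $-g'_0$ with the ordered thresholds remain; each follows by transitivity. *)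
by split=> [h|/andP[h1 h2]|/andP[h1 h2]|h]; split; lra.
Qed.
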